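(* Let $c_{n\ell}$ ($n=1,2$; $\ell=1,2,3$) be six complex numbers. Suppose there exist complex numbers $\rho_1,\rho_2$ and $b_{nm}$ ($n,m\in\{1,2\}$) with $B=b_{11}b_{22}-b_{12}b_{21}\neq0$ such that, setting $$a_{11}=\frac{b_{22}}{B},\quad a_{12}=-\frac{b_{12}}{B},\quad a_{21}=-\frac{b_{21}}{B},\quad a_{22}=\frac{b_{11}}{B},$$ one has, for $n=1,2$, $$c_{n1}=b_{n1}a_{11}^2+b_{n2}\left[\rho_1a_{11}^2+(\rho_2a_{11}+a_{21})a_{21}\right],$$ $$c_{n2}=2b_{n1}a_{11}a_{12}+b_{n2}\left[2\rho_1a_{11}a_{12}+\rho_2(a_{11}a_{22}+a_{12}a_{21})+2a_{21}a_{22}\right],$$ $$c_{n3}=b_{n1}a_{12}^2+b_{n2}\left[\rho_1a_{12}^2+(\rho_2a_{12}+a_{22})a_{22}\right].$$ Then the coefficients $c_{n\ell}$ satisfy the two algebraic constraints $$2c_{21}\left(c_{12}c_{22}-4c_{13}c_{21}\right)^2+(c_{22}-2c_{11})\left(c_{12}c_{22}-4c_{13}c_{21}\right)\left[(c_{22}-2c_{11})c_{22}+2c_{21}(c_{12}-2c_{23})\right]-c_{12}\left[(c_{22}-2c_{11})c_{22}+2c_{21}(c_{12}-2c_{23})\right]^2=0,$$ $$c_{22}\left(c_{12}c_{22}-4c_{13}c_{21}\right)^2-(c_{12}-2c_{23})\left(c_{12}c_{22}-4c_{13}c_{21}\right)\left[(c_{22}-2c_{11})c_{22}+2c_{21}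(c_{12}-2c_{23})\right]-2c_{13}\left[(c_{22}-2c_{11})c_{22}+2c_{21}(c_{12}-2c_{23})\right]^2=0.$$
   Context: The hypothesis says that the system $\dot x_n=c_{n1}x_1^2+c_{n2}x_1x_2+c_{n3}x_2^2$ ($n=1,2$) is obtained from the explicitly solvable system $\dot y_1=y_1^2$, $\dot y_2=\rho_1y_1^2+\rho_2y_1y_2+y_2^2$ by the invertible constant linear change of dependent variables $x_n=b_{n1}y_1+b_{n2}y_2$, with inverse $y_n=a_{n1}x_1+a_{n2}x_2$. All numbers may be complex. *)

(* Defs.v *)
From Stdlib Require Export Reals.
From Coquelicot Require Export Coquelicot.

(* Main.v *)
Require Import Defs.
From Stdlib Require Import Reals.
From Coquelicot Require Import Coquelicot.
Open Scope C_scope.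

(** Let [J u] be the Jacobian matrix at [u] of the quadratic vector field of the
    system; it is linear in [u].  In the [y] coordinates [y2] does not enter the
    first equation, so the axis [y1 = 0] is an eigendirection of every Jacobian:
    the one at [u] sends the second basis vector to [rho2 * u1 + 2 * u2] times
    itself.  In the [x] coordinates this axis is spanned by [w = (b12, b22)],
    which is therefore a common eigenvector of the two matrices [J e1] and
    [J e2], where [e1, e2] is the standard basis of the [x] plane (lemma
    [jacobian_row_on_invariant_axis]).

    That [w] is an eigenvector of [J e1] and of [J e2] means that two binary
    quadratic forms vanish at [w].  Eliminating the square of the first
    coordinate between them shows that [w] and [(P, Q)] are parallel, where [P]
    and [Q] are the two expressions that recur in the constraints; and the
    constraints say exactly that the two forms vanish at [(P, Q)] (lemma
    [common_root_of_binary_forms]). *)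

(** Taking [p] times the first form minus [a] times the second gives
    [w2 * (Q * w1 - P * w2) = 0].  If [w2 <> 0], then [(P, Q)] is a multiple of
    [w], and the forms are homogeneous; otherwise [w] spans the first axis, so
    [a = p = 0] and [(P, Q)] is zero. *)
Lemma common_root_of_binary_forms (a b c p q r w1 w2 : C) :
  w1 <> 0 \/ w2 <> 0 ->
  a * w1 ^ 2 + b * w1 * w2 + c * w2 ^ 2 = 0 ->
  p * w1 ^ 2 + q * w1 * w2 + r * w2 ^ 2 = 0 ->
  let P := a * r - c * p in
  let Q := b * p - a * q in
  a * P ^ 2 + b * P * Q + c * Q ^ 2 = 0 /\
  p * P ^ 2 + q * P * Q + r * Q ^ 2 = 0.
Proof.
intros Hw H1 H2 P Q.
destruct (Ceq_dec w2 0) as [W2 | W2].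
- assert (W1 : w1 <> 0) by tauto.
  assert (root_on_axis : forall k l m : C,
             k * w1 ^ 2 + l * w1 * w2 + m * w2 ^ 2 = 0 -> k = 0).
  { intros k l m H.
    replace k with ((k * w1 ^ 2 + l * w1 * w2 + m * w2 ^ 2) / w1 ^ 2)
      by (rewrite W2; field; exact W1).
    rewrite H; field; exact W1. }
  unfold P, Q; rewrite (root_on_axis _ _ _ H1), (root_on_axis _ _ _ H2).
  split; ring.
- set (t := Q / w2).
  assert (HQ : Q = t * w2) by (unfold t; field; exact W2).
  assert (HP : P = t * w1).
  { replace P with
      (t * w1 - (p * (a * w1 ^ 2 + b * w1 * w2 + c * w2 ^ 2)
                 - a * (p * w1 ^ 2 + q * w1 * w2 + r * w2 ^ 2)) / w2 ^ 2)
      by (unfold t, P, Q; field; exact W2).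
    rewrite H1, H2; field; exact W2. }
  rewrite HP, HQ; split.
  + transitivity (t ^ 2 * (a * w1 ^ 2 + b * w1 * w2 + c * w2 ^ 2)).
    * ring.
    * rewrite H1; ring.
  + transitivity (t ^ 2 * (p * w1 ^ 2 + q * w1 * w2 + r * w2 ^ 2)).
    * ring.
    * rewrite H2; ring.
Qed.

(** The rows [(a11, a12)] and [(a21, a22)] give the [y] coordinates of a vector,
    and the hypotheses say that those of [(w1, w2)] are [(0, 1)].  The three
    long expressions are the coefficients of the quadratic form
    [s * y1 ^ 2 + t * (rho1 * y1 ^ 2 + rho2 * y1 * y2 + y2 ^ 2)] in the [x]
    coordinates; the conclusions are its derivatives along [(w1, w2)], that is,
    with respect to [y2], at the two basis vectors of the [x] plane. *)
Lemma jacobian_row_on_invariant_axis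
    (rho1 rho2 a11 a12 a21 a22 w1 w2 s t : C) :
  a11 * w1 + a12 * w2 = 0 ->
  a21 * w1 + a22 * w2 = 1 ->
  let k1 := s * a11 ^ 2
            + t * (rho1 * a11 ^ 2 + (rho2 * a11 + a21) * a21) in
  let k2 := 2 * s * a11 * a12
            + t * (2 * rho1 * a11 * a12
                   + rho2 * (a11 * a22 + a12 * a21) + 2 * a21 * a22) in
  let k3 := s * a12 ^ 2
            + t * (rho1 * a12 ^ 2 + (rho2 * a12 + a22) * a22) in
  2 * k1 * w1 + k2 * w2 = (rho2 * a11 + 2 * a21) * t /\
  k2 * w1 + 2 * k3 * w2 = (rho2 * a12 + 2 * a22) * t.
Proof.
intros H0 H1 k1 k2 k3; unfold k1, k2, k3; split.
- transitivity
    ((2 * s * a11 + t * (2 * rho1 * a11 + rho2 * a21))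
       * (a11 * w1 + a12 * w2)
     + t * (rho2 * a11 + 2 * a21) * (a21 * w1 + a22 * w2)).
  + ring.
  + rewrite H0, H1; ring.
- transitivity
    ((2 * s * a12 + t * (2 * rho1 * a12 + rho2 * a22))
       * (a11 * w1 + a12 * w2)
     + t * (rho2 * a12 + 2 * a22) * (a21 * w1 + a22 * w2)).
  + ring.
  + rewrite H0, H1; ring.
Qed.

(** The determinant of [w] and [M w], for [M] the matrix with rows [(k, l)] and
    [(m, n)], vanishes when [w] is an eigenvector. *)
Lemma eigenvector_form (k l m n lambda w1 w2 : C) :
  k * w1 + l * w2 = lambda * w1 ->
  m * w1 + n * w2 = lambda * w2 ->
  m * w1 ^ 2 + (n - k) * w1 * w2 + - l * w2 ^ 2 = 0.
Proof.
intros H1 H2.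
transitivity ((m * w1 + n * w2) * w1 - (k * w1 + l * w2) * w2).
- ring.
- rewrite H1, H2; ring.
Qed.

Theorem mainTheorem3 :
  forall c11 c12 c13 c21 c22 c23 : C,
  (exists rho1 rho2 b11 b12 b21 b22 : C,
    let B := b11 * b22 - b12 * b21 in
    let a11 := b22 / B in
    let a12 := - (b12 / B) in
    let a21 := - (b21 / B) in
    let a22 := b11 / B in
    B <> 0 /\
    c11 = b11 * a11 ^ 2
          + b12 * (rho1 * a11 ^ 2 + (rho2 * a11 + a21) * a21) /\
    c12 = 2 * b11 * a11 * a12
          + b12 * (2 * rho1 * a11 * a12
                   + rho2 * (a11 * a22 + a12 * a21) + 2 * a21 * a22) /\
    c13 = b11 * a12 ^ 2
          + b12 * (rho1 * a12 ^ 2 + (rho2 * a12 + a22) * a22) /\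
    c21 = b21 * a11 ^ 2
          + b22 * (rho1 * a11 ^ 2 + (rho2 * a11 + a21) * a21) /\
    c22 = 2 * b21 * a11 * a12
          + b22 * (2 * rho1 * a11 * a12
                   + rho2 * (a11 * a22 + a12 * a21) + 2 * a21 * a22) /\
    c23 = b21 * a12 ^ 2
          + b22 * (rho1 * a12 ^ 2 + (rho2 * a12 + a22) * a22)) ->
  2 * c21 * (c12 * c22 - 4 * c13 * c21) ^ 2
  + (c22 - 2 * c11) * (c12 * c22 - 4 * c13 * c21)
    * ((c22 - 2 * c11) * c22 + 2 * c21 * (c12 - 2 * c23))
  - c12 * ((c22 - 2 * c11) * c22 + 2 * c21 * (c12 - 2 * c23)) ^ 2 = 0
  /\
  c22 * (c12 * c22 - 4 * c13 * c21) ^ 2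
  - (c12 - 2 * c23) * (c12 * c22 - 4 * c13 * c21)
    * ((c22 - 2 * c11) * c22 + 2 * c21 * (c12 - 2 * c23))
  - 2 * c13 * ((c22 - 2 * c11) * c22 + 2 * c21 * (c12 - 2 * c23)) ^ 2 = 0.
Proof.
intros c11 c12 c13 c21 c22 c23
  (rho1 & rho2 & b11 & b12 & b21 & b22 & HB
   & E11 & E12 & E13 & E21 & E22 & E23).
set (B := b11 * b22 - b12 * b21) in *.
assert (Hw : b12 <> 0 \/ b22 <> 0).
{ destruct (Ceq_dec b12 0) as [Z12 | N12]; [right | now left].
  intros Z22; apply HB; unfold B; rewrite Z12, Z22; ring. }
assert (y1_w : b22 / B * b12 + - (b12 / B) * b22 = 0) by (field; exact HB).
assert (y2_w : - (b21 / B) * b12 + b11 / B * b22 = 1).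
{ transitivity (B / B).
  - unfold B at 3; field; exact HB.
  - field; exact HB. }
destruct (jacobian_row_on_invariant_axis rho1 rho2 _ _ _ _ _ _ b11 b12
            y1_w y2_w) as [J1_1 J2_1].
destruct (jacobian_row_on_invariant_axis rho1 rho2 _ _ _ _ _ _ b21 b22
            y1_w y2_w) as [J1_2 J2_2].
rewrite <- E11, <- E12 in J1_1; rewrite <- E12, <- E13 in J2_1.
rewrite <- E21, <- E22 in J1_2; rewrite <- E22, <- E23 in J2_2.
destruct (common_root_of_binary_forms _ _ _ _ _ _ _ _ Hw
            (eigenvector_form _ _ _ _ _ _ _ J1_1 J1_2)
            (eigenvector_form _ _ _ _ _ _ _ J2_1 J2_2)) as [G1 G2].
split.
- rewrite <- G1; ring.
- rewrite <- G2; ring.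
Qed.
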